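(* Let $\mathfrak{B}$ be a bornology with a closed base on a topological space $X$. The following are equivalent. (1) $X$ satisfies $\alpha_2(\Gamma_{\mathfrak{B}},\boldsymbol{\Gamma}_{\mathfrak{B}})$. (2) $X$ satisfies $\alpha_3(\Gamma_{\mathfrak{B}},\boldsymbol{\Gamma}_{\mathfrak{B}})$. (3) $X$ satisfies $\alpha_4(\Gamma_{\mathfrak{B}},\boldsymbol{\Gamma}_{\mathfrak{B}})$. (4) $X$ satisfies $S_1(\Gamma_{\mathfrak{B}},\boldsymbol{\Gamma}_{\mathfrak{B}})$. (5) ONE has no winning strategy in the game $G_1(\Gamma_{\mathfrak{B}},\boldsymbol{\Gamma}_{\mathfrak{B}})$. (6) $X$ satisfies $\bigcap_\infty(\Gamma_{\mathfrak{B}},\boldsymbol{\Gamma}_{\mathfrak{B}})$.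
   Context: A bornology $\mathfrak{B}$ on $X$ is a family of subsets of $X$ that is closed under taking subsets and finite unions and covers $X$; by standing convention $X\notin\mathfrak{B}$. A base of $\mathfrak{B}$ is a subfamily $\mathfrak{B}_0\subseteq\mathfrak{B}$ such that every $B\in\mathfrak{B}$ is contained in some $B_0\in\mathfrak{B}_0$; it is closed if its members are closed subsets of $X$. A cover $\mathcal{U}=\{U_n:n\in\omega\}$ of $X$ by (arbitrary) subsets of $X$ is a $\mathfrak{B}$-sequence if it is infinite and for each $B\in\mathfrak{B}$ there is $n_0\in\omega$ with $B\subseteq U_n$ for all $n\ge n_0$. $\boldsymbol{\Gamma}_{\mathfrak{B}}$ (boldface) is the collection of all $\mathfrak{B}$-sequences of $X$. $\Gamma_{\mathfrak{B}}$ is the collection of all $\gamma_{\mathfrak{B}}$-covers of $X$, i.e. $\mathfrak{B}$-sequences all of whose members are proper open subsets of $X$. When membership in $\boldsymbol{\Gamma}_{\mathfrak{B}}$ of a family displayed as $\{W_n:n\in\omega\}$ is asserted, the displayed indexing is the one used. For collections $\mathcal{A},\mathcal{B}$ of families of subsets of $X$: $S_1(\mathcal{A},\mathcal{B})$: for each sequence $\{\mathcal{U}_n:n\in\omega\}$ of elements of $\mathcal{A}$ there are $V_n\in\mathcal{U}_n$ with $\{V_n:n\in\omega\}\in\mathcal{B}$. $G_1(\mathcal{A},\mathcal{B})$: in round $n\in\omega$ player ONE chooses $\mathcal{U}_n\in\mathcal{A}$ and TWO responds with $V_n\in\mathcal{U}_n$; TWO wins if $\{V_n:n\in\omega\}\in\mathcal{B}$,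 otherwise ONE wins. $\bigcap_\infty(\mathcal{A},\mathcal{B})$: for each sequence $\{\mathcal{U}_n:n\in\omega\}$ of elements of $\mathcal{A}$ there are infinite $\mathcal{V}_n\subseteq\mathcal{U}_n$ ($n\in\omega$) with $\{\bigcap\mathcal{V}_n:n\in\omega\}\in\mathcal{B}$. $\alpha_i(\mathcal{A},\mathcal{B})$ for $i=2,3,4$: for each sequence $\{\mathcal{U}_n:n\in\omega\}$ of elements of $\mathcal{A}$ there is $\mathcal{V}\in\mathcal{B}$ such that, for $i=2$: $\mathcal{U}_n\cap\mathcal{V}$ is infinite for every $n\in\omega$; for $i=3$: $\mathcal{U}_n\cap\mathcal{V}$ is infinite for infinitely many $n\in\omega$; for $i=4$: $\mathcal{U}_n\cap\mathcal{V}$ is nonempty for infinitely many $n\in\omega$. *)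

(* Defs.v *)
From mathcomp Require Import all_boot all_order.
From mathcomp Require Import boolp classical_sets functions cardinality.
From mathcomp Require Import topology.

Set Implicit Arguments.
Unset Strict Implicit.
Unset Printing Implicit Defensive.

Local Open Scope classical_set_scope.

Record bornology (X : Type) (B : set (set X)) : Prop := Bornology {
  bornology_sub : forall A C : set X, A `<=` C -> B C -> B A;
  bornology_union : forall A C : set X, B A -> B C -> B (A `|` C);
  bornology_cover : \bigcup_(A in B) A = [set: X];
  bornology_proper : ~ B [set: X] }.

Definition bornology_base (X : Type) (B B0 : set (set X)) : Prop :=
  B0 `<=` B /\ forall A, B A -> exists2 A0, B0 A0 & A `<=` A0.

Definition has_closed_base (X : topologicalType) (B : set (set X)) : Prop :=
  exists2 B0, bornology_base B B0 & forall A, B0 A -> closed A.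

(* A countable family {U_n : n in omega} is represented by its indexing
   U : nat -> set X (repetitions allowed), and a collection of such families by
   a set of indexings. "Infinite" refers to the number of distinct members. *)
Definition bornology_sequences (X : Type) (B : set (set X)) :
    set (nat -> set X) :=
  [set U | [/\ \bigcup_n U n = [set: X],
               infinite_set (range U) &
               forall A, B A -> exists n0, forall n, (n0 <= n)%N -> A `<=` U n]].

Definition gamma_covers (X : topologicalType) (B : set (set X)) :
    set (nat -> set X) :=
  [set U | bornology_sequences B U /\
           forall n, open (U n) /\ U n <> [set: X]].

(* The unindexed families of a collection: the sets {U_n : n in omega} for U
   ranging over the admissible indexings. *)
Definition families (X : Type) (A : set (nat -> set X)) : set (set (set X)) :=
  [set range U | U in A].

Definition selection1 (X : Type) (A B : set (nat -> set X)) : Prop :=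
  forall U : nat -> set (set X), (forall n, families A (U n)) ->
  exists2 V : nat -> set X, forall n, U n (V n) & B V.

Definition selection_cap_infty (X : Type) (A B : set (nat -> set X)) : Prop :=
  forall U : nat -> set (set X), (forall n, families A (U n)) ->
  exists2 V : nat -> set (set X),
    forall n, V n `<=` U n /\ infinite_set (V n) &
    B (fun n => \bigcap_(W in V n) W).

Definition alpha2 (X : Type) (A B : set (nat -> set X)) : Prop :=
  forall U : nat -> set (set X), (forall n, families A (U n)) ->
  exists2 V, families B V & forall n, infinite_set (U n `&` V).

Definition alpha3 (X : Type) (A B : set (nat -> set X)) : Prop :=
  forall U : nat -> set (set X), (forall n, families A (U n)) ->
  exists2 V, families B V &
    infinite_set [set n | infinite_set (U n `&` V)].

Definition alpha4 (X : Type) (A B : set (nat -> set X)) : Prop :=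
  forall U : nat -> set (set X), (forall n, families A (U n)) ->
  exists2 V, families B V & infinite_set [set n | U n `&` V !=set0].

(* In the game G_1(A, B), a strategy s of ONE maps the list of the previous
   moves of TWO, in order of play, to the next move of ONE. Its values matter
   only at the positions where TWO has obeyed the rules against s. *)
Definition legal_position (X : Type) (s : seq (set X) -> set (set X))
    (h : seq (set X)) : Prop :=
  forall i, (i < size h)%N -> s (take i h) (nth set0 h i).

Definition ONE_strategy (X : Type) (A : set (nat -> set X))
    (s : seq (set X) -> set (set X)) : Prop :=
  forall h, legal_position s h -> families A (s h).

Definition ONE_winning_strategy (X : Type) (A B : set (nat -> set X))
    (s : seq (set X) -> set (set X)) : Prop :=
  ONE_strategy A s /\
  forall V : nat -> set X, (forall n, s (mkseq V n) (V n)) -> ~ B V.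

(* Main.v *)
Require Import Defs.
From mathcomp Require Import all_boot all_order.
From mathcomp Require Import boolp classical_sets functions cardinality.
From mathcomp Require Import topology.

Local Open Scope classical_set_scope.

Set Implicit Arguments.
Unset Strict Implicit.
Unset Printing Implicit Defensive.

(** Call a family [U] of sets exhausting when every bounded set is contained in
    all but finitely many of the [U i]. If no [U i] is the whole space, then
    infinitely many indices already give infinitely many members
    ([exhausts_infinite_range]): a member repeated infinitely often would
    contain every bounded set, hence every point. So for proper members being a
    B-sequence is just being exhausting. This no longer depends on the order of
    the indices, and it passes to injective subfamilies and to larger sets, so
    families can be indexed by any countable type (pairs of naturals, finite
    sequences of naturals), where finiteness replaces tails.

    The two substantial implications are the following.

    - From alpha_4 to S_1. Replace the n-th cover by the cover of all
      meets of the k-th members of the first n + 1 covers, and thin these covers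
      out so that distinct covers share no member. Thinning is essential: a
      single set belonging to all the covers would otherwise witness alpha_4 at
      every n. After thinning, a B-sequence meeting infinitely many covers picks
      an exhausting family of meets, and each meet at a stage n >= m lies
      inside a member of the m-th given cover, which is then selected.

    - From S_1 to the game. Indexing the members of each move of ONE by naturals
      turns a strategy of ONE into a tree of covers indexed by finite sequences
      of naturals. Apply S_1 to this countable family at once; following the
      selected members from the root gives a play, and its positions are
      pairwise distinct nodes, so the play inherits exhaustion and beats the
      strategy.

    Conversely a failure of S_1 is a strategy of ONE that ignores TWO. S_1
    applied with each cover listed infinitely often gives alpha_2. Finally,
    alpha_2 and the intersection property are exchanged by discarding the first
    n members of the B-sequence before intersecting, respectively by uniting
    infinite parts of the subfamilies. *)

(** * Finite sets and injective choices *)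

Lemma finite_set_nat_bounded (S : set nat) :
  finite_set S -> exists N, forall n, S n -> (n < N)%N.
Proof.
move=> /finite_seqP[s ->]; exists (\max_(i <- s) i).+1 => n /= ns.
by rewrite ltnS; exact: (leq_bigmax_seq (F := id)).
Qed.

Lemma infinite_set_nat_ge (S : set nat) (m : nat) :
  infinite_set S -> exists2 n, S n & (m <= n)%N.
Proof.
move=> Sinf; have [n [Sn /negP]] := infinite_setN0 (infinite_setD Sinf (finite_II m)).
by rewrite -leqNgt; exists n.
Qed.

Lemma infinite_range_injective (I T : Type) (f : I -> T) :
  infinite_set [set: I] -> injective f -> infinite_set (range f).
Proof.
move=> Iinf finj /(finite_preimage (f := f))-/(_ (in2W finj)) fin.
by apply: Iinf; apply: sub_finite_set fin => i _; exists i.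
Qed.

(** Diagonal argument: at each stage only finitely many elements are already
    taken, so an infinite set still offers a fresh one. *)
Lemma injective_choice_nat (T : Type) (S : nat -> set T) :
  (forall n, infinite_set (S n)) ->
  exists2 f : nat -> T, injective f & forall n, S n (f n).
Proof.
move=> Sinf; have [t0 _] := infinite_setN0 (Sinf 0).
have /choice[g gP] (p : nat * set T) :
    exists t, finite_set p.2 -> S p.1 t /\ ~ p.2 t.
  case: p => n F /=; have [Ffin|] := pselect (finite_set F); last by exists t0.
  by have [t [St Ft]] := infinite_setN0 (infinite_setD (Sinf n) Ffin); exists t.
pose used := fix used n :=
  if n is m.+1 then used m `|` [set g (m, used m)] else set0.
have used_fin n : finite_set (used n).
  by elim: n => [|n IH] /=; [exact: finite_set0 | rewrite finite_setU; split].
pose f n := g (n, used n).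
have usedP n m : (m < n)%N -> used n (f m).
  elim: n => // n IH; rewrite ltnS leq_eqVlt => /predU1P[->|/IH]; first by right.
  by left.
exists f => [m n fmn|n]; last by have [] := gP _ (used_fin n : finite_set (n, used n).2).
have fresh k : ~ used k (f k) by have [] := gP _ (used_fin k : finite_set (k, used k).2).
case: (ltngtP m n) => // [/usedP|/usedP]; first by rewrite fmn => /fresh.
by rewrite -fmn => /fresh.
Qed.

(** Applied to pairs (n, k) with [S] depending on n only, this thins a sequence of
    infinite sets out to pairwise disjoint infinite subsets, each of them
    enumerated without repetition. *)
Lemma injective_choice (I : countType) (T : Type) (i0 : I) (S : I -> set T) :
  (forall i, infinite_set (S i)) ->
  exists2 f : I -> T, injective f & forall i, S i (f i).
Proof.
move=> Sinf.
have [f finj fS] := injective_choice_nat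
  (S := fun n => S (odflt i0 (unpickle n)))
  (fun n => Sinf _).
exists (f \o pickle) => [i j /finj /(pcan_inj pickleK)//|i].
by have := fS (pickle i); rewrite pickleK.
Qed.

(** * Families exhausting a bornology *)

Definition exhausts (X I : Type) (B : set (set X)) (U : I -> set X) : Prop :=
  forall A, B A -> finite_set [set i | ~ A `<=` U i].

(** For sequences, the condition that bounded sets are eventually contained in
    the members is invariant under permutations of the indices. *)
Lemma exhausts_natP (X : Type) (B : set (set X)) (U : nat -> set X) :
  exhausts B U <->
  forall A, B A -> exists n0, forall n, (n0 <= n)%N -> A `<=` U n.
Proof.
split=> UB A /UB => [/finite_set_nat_bounded[N NP]|[n0 n0P]].
  by exists N => n Nn; apply: contrapT => /NP; rewrite ltnNge Nn.
apply: sub_finite_set (finite_II n0) => n /= nA; rewrite ltnNge.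
by apply/negP => /n0P.
Qed.

Lemma exhausts_reindex (X I J : Type) (B : set (set X)) (U : I -> set X)
    (g : J -> I) (V : J -> set X) :
  injective g -> (forall j, U (g j) `<=` V j) ->
  exhausts B U -> exhausts B V.
Proof.
move=> ginj UV UB A /UB /(finite_preimage (f := g))-/(_ (in2W ginj)).
by apply: sub_finite_set => j /= nA AU; apply: nA; apply: subset_trans AU (UV j).
Qed.

Lemma exhausts_injective (X I J : Type) (B : set (set X)) (U : I -> set X)
    (V : J -> set X) :
  injective V -> (forall j, range U (V j)) ->
  exhausts B U -> exhausts B V.
Proof.
move=> Vinj VU; have /choice[g gP] j : exists i, U i = V j.
  by have [i _ <-] := VU j; exists i.
apply: (exhausts_reindex (g := g)) => [i j gij|j]; last by rewrite gP.
by apply: Vinj; rewrite -!gP gij.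
Qed.

Lemma exhausts_setI (X I : Type) (B : set (set X)) (U V : I -> set X) :
  exhausts B U -> exhausts B V ->
  exhausts B (fun i => U i `&` V i).
Proof.
move=> UB VB A BA; have fin : finite_set
    ([set i | ~ A `<=` U i] `|` [set i | ~ A `<=` V i]).
  by rewrite finite_setU; split; [exact: UB | exact: VB].
apply: sub_finite_set fin => i /= nA.
apply/not_andP => -[AU AV]; apply: nA => x Ax.
by split; [exact: AU | exact: AV].
Qed.

(** If a member [W] misses a point, some bounded set escapes [W], so [W] has
    only finitely many indices; hence infinitely many indices give infinitely
    many members. *)
Lemma exhausts_infinite_range (X I : Type) (B : set (set X)) (U : I -> set X) :
  bornology B -> infinite_set [set: I] -> (forall i, U i <> [set: X]) ->
  exhausts B U -> infinite_set (range U).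
Proof.
move=> HB Iinf Uproper UB rfin; apply: Iinf.
have fin : finite_set (\bigcup_(W in range U) (U @^-1` [set W])).
  apply: bigcup_finite => // W [i _ <-].
  have [x Ux] : exists x, ~ U i x.
    by apply/existsNP => allx; apply: (Uproper i); apply/seteqP; split.
  have [A BA Ax] : (\bigcup_(A in B) A) x by rewrite (bornology_cover HB).
  by apply: sub_finite_set (UB A BA) => j /= -> /(_ x Ax).
by apply: sub_finite_set fin => i _; exists (U i) => //; exists i.
Qed.

(** Points are bounded, so an exhausting sequence is automatically a cover. *)
Lemma bornology_sequences_intro (X : Type) (B : set (set X))
    (U : nat -> set X) :
  bornology B -> (forall n, U n <> [set: X]) -> exhausts B U ->
  bornology_sequences B U.
Proof.
move=> HB Uproper UB; split; last exact/exhausts_natP.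
  apply/seteqP; split=> // x _.
  have [A BA Ax] : (\bigcup_(A in B) A) x by rewrite (bornology_cover HB).
  have [n nP] := (exhausts_natP _ _).1 UB A BA.
  by exists n => //; apply: (nP n).
exact: exhausts_infinite_range infinite_nat Uproper UB.
Qed.

Lemma bornology_sequences_exhausts (X : Type) (B : set (set X))
    (U : nat -> set X) :
  bornology_sequences B U -> exhausts B U.
Proof. by case=> _ _ UB; apply/exhausts_natP. Qed.

(** Exhaustion is insensitive to the order of the indices, so any bijective
    enumeration of [I] serves. *)
Lemma families_intro (X : Type) (I : countType) (B : set (set X))
    (U : I -> set X) :
  bornology B -> infinite_set [set: I] -> (forall i, U i <> [set: X]) ->
  exhausts B U -> families (bornology_sequences B) (range U).
Proof.
move=> HB Iinf Uproper UB.
have /card_set_bijP[r [_ rinj rsurj]] := eq_card_nat (countableP [set: I]) Iinf.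
have /choice[e eK] n : exists i, r i = n.
  by have [i _ <-] := rsurj n Logic.I; exists i.
have rK i : e (r i) = i by apply: rinj; rewrite ?inE ?eK.
have -> : range U = range (U \o e).
  apply/seteqP; split=> [W [i _ <-]|W [n _ <-]]; last by exists (e n).
  by exists (r i) => //=; rewrite rK.
exists (U \o e) => //; apply: bornology_sequences_intro => // [n|].
  exact: Uproper.
apply: (exhausts_reindex (g := e)) UB => [m n emn|n //].
by rewrite -(eK m) emn eK.
Qed.

Lemma gamma_coversP (X : topologicalType) (B : set (set X))
    (U : nat -> set X) : bornology B ->
  gamma_covers B U <->
  [/\ exhausts B U, forall n, open (U n) & forall n, U n <> [set: X]].
Proof.
move=> HB; split=> [[/bornology_sequences_exhausts UB UP]|[UB Uo Up]].
  by split=> // n; have [] := UP n.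
by split=> [|n]; [exact: bornology_sequences_intro|split].
Qed.

Lemma families_gamma_proper (X : topologicalType) (B : set (set X))
    (S : set (set X)) (W : set X) :
  families (gamma_covers B) S -> S W -> W <> [set: X].
Proof. by case=> U [_ UP] <- [n _ <-]; have [] := UP n. Qed.

Lemma families_gamma_infinite (X : topologicalType) (B : set (set X))
    (S : set (set X)) :
  families (gamma_covers B) S -> infinite_set S.
Proof. by case=> U [[_ Uinf _] _] <-. Qed.

Lemma families_gamma_exhausts (X : topologicalType) (I : Type) (B : set (set X))
    (S : set (set X)) (V : I -> set X) :
  families (gamma_covers B) S -> injective V -> (forall i, S (V i)) ->
  exhausts B V.
Proof.
case=> U [/bornology_sequences_exhausts UB _] <- Vinj VU.
exact: exhausts_injective Vinj VU UB.
Qed.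

Lemma gamma_covers_sub (X : topologicalType) (B : set (set X))
    (S : set (set X)) (V : nat -> set X) : bornology B ->
  families (gamma_covers B) S -> injective V -> (forall n, S (V n)) ->
  gamma_covers B V.
Proof.
move=> HB SB Vinj VS; apply/gamma_coversP => //; split=> [|n|n].
- exact: families_gamma_exhausts SB Vinj VS.
- by case: SB (VS n) => U [_ UP] <- [k _ <-]; have [] := UP k.
- exact: families_gamma_proper SB (VS n).
Qed.

(** * Meets of covers *)

Fixpoint meets (X : Type) (U : nat -> nat -> set X) (n : nat) : nat -> set X :=
  if n is m.+1 then fun k => meets U m k `&` U n k else U 0.

Lemma meets_sub (X : Type) (U : nat -> nat -> set X) (m n k : nat) :
  (m <= n)%N -> meets U n k `<=` U m k.
Proof.
elim: n => [|n IH] /=; first by rewrite leqn0 => /eqP ->.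
rewrite leq_eqVlt => /predU1P[->|/IH Um]; first exact: subIsetr.
by apply: subset_trans Um; exact: subIsetl.
Qed.

(** A meet of open proper sets is open and proper, so only exhaustion can fail,
    and it survives finite meets; the range stays infinite although distinct
    members may have equal meets. *)
Lemma gamma_covers_meets (X : topologicalType) (B : set (set X))
    (U : nat -> nat -> set X) : bornology B ->
  (forall n, gamma_covers B (U n)) -> forall n, gamma_covers B (meets U n).
Proof.
move=> HB UB; elim=> [|n /(gamma_coversP _ HB)[IHB IHo IHp]]; first exact: UB.
have /(gamma_coversP _ HB)[UnB Uno _] := UB n.+1.
apply/gamma_coversP => //; split=> [|k|k /= WT].
- exact: exhausts_setI.
- exact: openI.
- by apply: (IHp k); apply/seteqP; split=> // x; rewrite -WT => -[].
Qed.

(** * The implications *)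

Lemma alpha2_alpha3 (X : Type) (A C : set (nat -> set X)) :
  alpha2 A C -> alpha3 A C.
Proof.
move=> a2 U UA; have [V VC UV] := a2 U UA; exists V => //.
by apply: sub_infinite_set infinite_nat => n _; exact: UV.
Qed.

Lemma alpha3_alpha4 (X : Type) (A C : set (nat -> set X)) :
  alpha3 A C -> alpha4 A C.
Proof.
move=> a3 U UA; have [V VC UV] := a3 U UA; exists V => //.
by apply: sub_infinite_set UV => n /= /infinite_setN0.
Qed.

(** The covers to which [alpha4] is applied consist of meets, so that a
    member met at stage [n] can be enlarged to a member of any earlier cover,
    filling the stages that [alpha4] skips, and they are pairwise disjoint, so
    that the sets met at distinct stages are distinct. *)
Lemma alpha4_selection1 (X : topologicalType) (B : set (set X)) :
  bornology B -> alpha4 (gamma_covers B) (bornology_sequences B) ->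
  selection1 (gamma_covers B) (bornology_sequences B).
Proof.
move=> HB a4 U UB.
have /choice[u uP] n : exists u, gamma_covers B u /\ range u = U n.
  by have [u uB uU] := UB n; exists u.
pose W n := range (meets u n).
have WB n : families (gamma_covers B) (W n).
  by exists (meets u n) => //; apply: gamma_covers_meets => // i; have [] := uP i.
have [f finj fW] := injective_choice (0, 0)
  (S := fun p => W p.1) (fun p : nat * nat => families_gamma_infinite (WB p.1)).
have rowB n : families (gamma_covers B) (range (fun k => f (n, k))).
  exists (fun k => f (n, k)) => //; apply: gamma_covers_sub HB (WB n) _ _.
    by move=> k l /finj[].
  by move=> k; exact: (fW (n, k)).
have [V [v /bornology_sequences_exhausts vB <-] vinf] := a4 _ rowB.
have /choice[p pP] m : exists p : nat * nat, (m <= p.1)%N /\ range v (f p).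
  have [n [_ [[k _ <-] vk]] mn] := infinite_set_nat_ge m vinf.
  by exists (n, k).
have /choice[k kP] m : exists k, f (p m) `<=` u m k.
  have [k _ <-] := fW (p m); exists k.
  exact: meets_sub (pP m).1.
exists (fun m => u m (k m)) => [m|].
  by have [_ <-] := uP m; exists (k m).
apply: bornology_sequences_intro => // [m|A BA].
  by have [[_ /(_ (k m))[]]] := uP m.
(* Each bad [v j] equals [f p] for at most one pair [p], so bad pairs occur at
   boundedly many stages; as stage [(p m).1] is at least [m], so is every bad
   [m]. *)
have fin : finite_set (fst @` (f @^-1` (v @` [set j | ~ A `<=` v j]))).
  by apply/finite_image/finite_preimage; [exact: in2W|apply/finite_image/vB].
have [N NP] := finite_set_nat_bounded fin.
apply: sub_finite_set (finite_II N) => m /= nA.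
apply: leq_ltn_trans (pP m).1 _; apply: NP; exists (p m) => //=.
have [_ [j _ vj]] := pP m; exists j => //=; rewrite vj => Af; apply: nA.
exact: subset_trans Af (kP m).
Qed.

Lemma selection1_countable (X : topologicalType) (I : countType) (i0 : I)
    (B : set (set X)) (U : I -> set (set X)) :
  selection1 (gamma_covers B) (bornology_sequences B) ->
  (forall i, families (gamma_covers B) (U i)) ->
  exists2 V : I -> set X, forall i, U i (V i) & exhausts B V.
Proof.
move=> s1 UB.
have [V VU /bornology_sequences_exhausts VB] :=
  s1 (fun n => U (odflt i0 (unpickle n))) (fun n => UB _).
exists (V \o pickle) => [i|]; first by have := VU (pickle i); rewrite pickleK.
exact: exhausts_reindex (pcan_inj pickleK) (fun i => @subset_refl _ _) VB.
Qed.

(** Listing the n-th cover at all pairs (n, k) makes the selector pick from it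
    infinitely often, and the picks on one row form an exhausting family, hence
    are infinitely many distinct sets. *)
Lemma selection1_alpha2 (X : topologicalType) (B : set (set X)) :
  bornology B -> selection1 (gamma_covers B) (bornology_sequences B) ->
  alpha2 (gamma_covers B) (bornology_sequences B).
Proof.
move=> HB s1 U UB.
have [V VU VB] := selection1_countable (0, 0)
  (U := fun p => U p.1) s1 (fun p : nat * nat => UB p.1).
have Vproper p : V p <> [set: X] := families_gamma_proper (UB p.1) (VU p).
exists (range V); first exact: families_intro infinite_prod_nat Vproper VB.
move=> n; have : infinite_set (range (fun k => V (n, k))).
  apply: exhausts_infinite_range HB infinite_nat _ _ => [k|]; first exact: Vproper.
  by apply: (exhausts_reindex (g := pair n)) VB => [k l []|k].
by apply: sub_infinite_set => W [k _ <-]; split; [exact: (VU (n, k))|exists (n, k)].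
Qed.

(** The position in which TWO has answered with the members of numbers [t] in
    the successive moves of ONE, where [u h] enumerates the move of ONE at the
    position [h]. *)
Definition branch_position (X : Type) (u : seq (set X) -> nat -> set X)
    (t : seq nat) : seq (set X) :=
  foldl (fun h k => rcons h (u h k)) [::] t.

Lemma legal_position_rcons (X : Type) (s : seq (set X) -> set (set X))
    (h : seq (set X)) (W : set X) :
  legal_position s h -> s h W -> legal_position s (rcons h W).
Proof.
move=> hs hW i; rewrite size_rcons ltnS leq_eqVlt => /predU1P[->|ih].
  by rewrite -cats1 take_size_cat // nth_cat ltnn subnn.
by rewrite -cats1 take_cat nth_cat ih; apply: hs.
Qed.

(** One application of [selection1] to the whole tree of positions decides an
    answer at every node, and an infinite branch obeying these answers is a play
    that TWO wins. *)
Lemma selection1_no_winning_strategy (X : topologicalType) (B : set (set X)) :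
  bornology B -> selection1 (gamma_covers B) (bornology_sequences B) ->
  ~ (exists s : seq (set X) -> set (set X),
       ONE_winning_strategy (gamma_covers B) (bornology_sequences B) s).
Proof.
move=> HB s1 [s [sB swin]].
have /choice[u uP] h : exists u : nat -> set X,
    legal_position s h -> range u = s h.
  have [/sB[u _ us]|] := pselect (legal_position s h).
    by exists u.
  (* At illegal positions the enumeration is arbitrary. *)
  by exists (fun=> set0).
pose pos := branch_position u.
have posS t k : pos (rcons t k) = rcons (pos t) (u (pos t) k).
  by rewrite /pos /branch_position foldl_rcons.
have pos_legal t : legal_position s (pos t).
  elim/last_ind: t => [//|t k IH]; rewrite posS.
  by apply: legal_position_rcons => //; rewrite -uP //; exists k.
have [V Vs VB] := selection1_countable [::] (U := fun t => s (pos t)) s1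
  (fun t : seq nat => sB _ (pos_legal t)).
have /choice[k kV] t : exists k, u (pos t) k = V t.
  by have := Vs t; rewrite -uP // => -[k _ <-]; exists k.
pose branch n := iter n (fun t => rcons t (k t)) [::].
have branch_inj : injective branch.
  have size_branch n : size (branch n) = n.
    by elim: n => //= n IH; rewrite size_rcons IH.
  by move=> m n /(congr1 size); rewrite !size_branch.
have posE n : pos (branch n) = mkseq (V \o branch) n.
  by elim: n => [//|n IH]; rewrite mkseqS -IH /= posS kV.
apply: (swin (V \o branch)) => [n|]; first by rewrite -posE; exact: Vs.
apply: bornology_sequences_intro => // [n|].
  exact: families_gamma_proper (sB _ (pos_legal _)) (Vs (branch n)).
exact: exhausts_reindex branch_inj (fun n => @subset_refl _ _) VB.
Qed.

(** A sequence of covers is a strategy of ONE that only counts the rounds. *)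
Lemma no_winning_strategy_selection1 (X : Type) (A C : set (nat -> set X)) :
  ~ (exists s : seq (set X) -> set (set X), ONE_winning_strategy A C s) ->
  selection1 A C.
Proof.
move=> nowin U UA; apply: contrapT => noV; apply: nowin.
exists (fun h => U (size h)); split=> [h _|V VU CV]; first exact: UA.
by apply: noV; exists V => // n; have := VU n; rewrite size_mkseq.
Qed.

(** Removing the first [n] members of the B-sequence [v] from its part in the
    n-th cover keeps that part infinite, and puts the intersection above every
    set contained in all [v j] with [n <= j]. *)
Lemma alpha2_cap_infty (X : topologicalType) (B : set (set X)) :
  bornology B -> alpha2 (gamma_covers B) (bornology_sequences B) ->
  selection_cap_infty (gamma_covers B) (bornology_sequences B).
Proof.
move=> HB a2 U UB.
have [V [v /bornology_sequences_exhausts vB <-] Uv] := a2 U UB.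
pose W n := (U n `&` range v) `\` (v @` `I_n).
have Winf n : infinite_set (W n).
  by apply: infinite_setD => //; apply/finite_image/finite_II.
exists W => [n|]; first by split=> // S [[]].
apply: bornology_sequences_intro => // [n capT|A BA].
  have [S WS] := infinite_setN0 (Winf n); have [[US _] _] := WS.
  apply: (families_gamma_proper (UB n) US).
  by apply/seteqP; split=> // x; rewrite -capT => /(_ S WS).
have [N NP] := (exhausts_natP _ _).1 vB A BA.
apply: sub_finite_set (finite_II N) => n /= nA; rewrite ltnNge.
apply/negP => Nn; apply: nA => x Ax S [[_ [j _ <-]] vj].
apply: NP Ax; apply: leq_trans Nn _; rewrite leqNgt; apply/negP => jn.
by apply: vj; exists j.
Qed.

(** Infinite parts of the selected subfamilies, chosen without repetition, unite
    to a B-sequence: a bounded set is inside every member of all but finitely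
    many subfamilies, and each of the remaining ones is part of a gamma-cover,
    hence has finitely many exceptions. *)
Lemma cap_infty_alpha2 (X : topologicalType) (B : set (set X)) :
  bornology B -> selection_cap_infty (gamma_covers B) (bornology_sequences B) ->
  alpha2 (gamma_covers B) (bornology_sequences B).
Proof.
move=> HB cap U UB.
have [V VU /bornology_sequences_exhausts VB] := cap U UB.
have [f finj fV] := injective_choice (0, 0)
  (S := fun p => V p.1) (fun p : nat * nat => (VU p.1).2).
have fU p : U p.1 (f p) by apply: (VU p.1).1; exact: fV.
have row_inj n : injective (fun k => f (n, k)) by move=> k l /finj[].
exists (range f) => [|n]; last first.
  apply: sub_infinite_set (infinite_range_injective infinite_nat (row_inj n)).
  by move=> W [k _ <-]; split; [exact: (fU (n, k))|exists (n, k)].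
apply: families_intro => // [|p|A BA]; first exact: infinite_prod_nat.
  exact: families_gamma_proper (UB p.1) (fU p).
have fin : finite_set (\bigcup_(n in [set n | ~ A `<=` \bigcap_(W in V n) W])
    (pair n @` [set k | ~ A `<=` f (n, k)])).
  apply: bigcup_finite (VB A BA) _ => n _; apply: finite_image.
  exact: families_gamma_exhausts (UB n) (row_inj n) (fun k => fU (n, k)) A BA.
apply: sub_finite_set fin => -[n k] /= nA; exists n; last by exists k.
by move=> AV; apply: nA => x /AV; apply; exact: (fV (n, k)).
Qed.

Unset Implicit Arguments.

Theorem theorem3p22 (X : topologicalType) (B : set (set X))
    (HB : bornology B) (Hbase : has_closed_base B) :
  [<-> alpha2 (gamma_covers B) (bornology_sequences B);
       alpha3 (gamma_covers B) (bornology_sequences B);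
       alpha4 (gamma_covers B) (bornology_sequences B);
       selection1 (gamma_covers B) (bornology_sequences B);
       ~ (exists s : seq (set X) -> set (set X),
            ONE_winning_strategy (gamma_covers B) (bornology_sequences B) s);
       selection_cap_infty (gamma_covers B) (bornology_sequences B)].
Proof.
tfae.
- exact: alpha2_alpha3.
- exact: alpha3_alpha4.
- exact: alpha4_selection1.
- exact: selection1_no_winning_strategy.
- move=> /no_winning_strategy_selection1/(selection1_alpha2 HB).
  exact: alpha2_cap_infty.
- exact: cap_infty_alpha2.
Qed.
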